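(* Let $f:\mathbb{R}^n\to\mathbb{R}$ be strongly convex and twice differentiable, and let $0<\beta_1<\beta_2$ be constants such that $\beta_1 I\preceq \nabla^2 f(x^\star+t(x-x^\star))\preceq \beta_2 I$ for all $x\in\mathbb{R}^n$ and all $t\in[0,1]$. Let $h(x)=Cx+d$ with $C\in\mathbb{R}^{m\times n}$ of full rank, $d\in\mathbb{R}^m$, and let $0<\alpha_1\le\alpha_2$ be such that $\alpha_1 I\preceq CC^\top\preceq\alpha_2 I$. Here $(x^\star,\lambda^\star)\in\mathbb{R}^n\times\mathbb{R}^m$ is the unique pair satisfying $\nabla f(x^\star)+C^\top\lambda^\star=0$ and $Cx^\star+d=0$. Let $K_i>0$ and $K_p>0$ satisfy $$K_p<\frac{2K_i}{\beta_2}.$$ Then for every solution $(x(t),\lambda(t))$, $t\ge 0$, of the PI-CMO dynamics $$\dot x=-\nabla f(x)-C^\top\lambda,\qquad \dot\lambda=-K_p\,C\left[\nabla f(x)+C^\top\lambda\right]+K_i\,(Cx+d),$$ with arbitrary initial condition $(x(0),\lambda(0))\in\mathbb{R}^n\times\mathbb{R}^m$, there exist real positive constants $c_1,c_2$ such that for all $t\ge 0$ $$\|x(t)-x^\star\|_2\le c_1e^{-\frac12\mu t},\qquad \|\lambda(t)-\lambda^\star\|_2\le c_2e^{-\frac12\mu t},$$ where $$\mu=\min\left\{K_p\alpha_1,\;2\beta_1-\frac{K_p}{K_i}\beta_1\beta_2\right\}>0.$$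
   Context: The underlying optimization problem is $\min_{x\in\mathbb{R}^n} f(x)$ subject to $h(x)=0$. For symmetric matrices, $M\preceq N$ means that $N-M$ is positive semidefinite; $\|\cdot\|_2$ is the Euclidean norm. The PI-CMO dynamics arises from the system $\dot x=-\nabla f(x)-J_h(x)^\top\lambda$, $y=h(x)$ (with $J_h$ the Jacobian of $h$) under the proportional-integral feedback law $\dot\lambda=K_p\dot y+K_iy$. The constants $c_1,c_2$ may depend on the initial condition. *)

(* Defs.v *)
From HB Require Import structures.
From mathcomp Require Import all_boot all_order all_algebra.
From mathcomp Require Import all_classical all_reals all_analysis.

Set Implicit Arguments.
Unset Strict Implicit.
Unset Printing Implicit Defensive.

Import Order.TTheory GRing.Theory Num.Theory.
Import numFieldNormedType.Exports.

Local Open Scope classical_set_scope.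
Local Open Scope ring_scope.

(* The library norm `|v| on matrices is the sup norm, which induces the same
   topology (hence the same derivatives) but is not the Euclidean norm. *)
Definition enorm {R : realType} {n : nat} (v : 'cV[R]_n) : R :=
  Num.sqrt (\sum_i v i 0 ^+ 2).

Definition gradient {R : realType} {n : nat} (f : 'cV[R]_n -> R)
    (x : 'cV[R]_n) : 'cV[R]_n :=
  \col_i 'D_(delta_mx i 0) f x.

Definition hessian {R : realType} {n : nat} (f : 'cV[R]_n -> R)
    (x : 'cV[R]_n) : 'M[R]_n :=
  \matrix_(i, j) 'D_(delta_mx j 0) (fun y => gradient f y i 0) x.

(* Twice Frechet differentiable; the Hessian need not be continuous. *)
Definition twice_differentiable {R : realType} {n : nat}
    (f : 'cV[R]_n -> R) : Prop :=
  forall x, differentiable f x /\ differentiable (gradient f) x.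

Definition strongly_convex {R : realType} {n : nat}
    (f : 'cV[R]_n -> R) : Prop :=
  exists2 s : R, 0 < s &
    forall (x y : 'cV[R]_n) (t : R), 0 <= t <= 1 ->
      f (t *: x + (1 - t) *: y) <=
        t * f x + (1 - t) * f y - s / 2 * t * (1 - t) * enorm (x - y) ^+ 2.

(* Symmetry of M is not part of the definition: it is only applied to
   differences of symmetric matrices (the Hessian of a twice Frechet
   differentiable function is symmetric). *)
Definition psdmx {R : realType} {n : nat} (M : 'M[R]_n) : Prop :=
  forall v : 'cV[R]_n, 0 <= (v^T *m M *m v) 0 0.

Definition loewner_le {R : realType} {n : nat} (M N : 'M[R]_n) : Prop :=
  psdmx (N - M).

(* A solution on [0, +oo[: x and lam are right-continuous at 0, differentiable
   on ]0, +oo[, and satisfy the differential equations there. Since the right-hand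
   sides are continuous, the equations then also hold at t = 0 for the right
   derivatives. *)
Definition pi_cmo_solution {R : realType} {n m : nat} (f : 'cV[R]_n -> R)
    (C : 'M[R]_(m, n)) (d : 'cV[R]_m) (Kp Ki : R)
    (x : R -> 'cV[R]_n) (lam : R -> 'cV[R]_m) : Prop :=
  [/\ derivable_oy_Rcontinuous x 0,
      derivable_oy_Rcontinuous lam 0,
      forall t, 0 < t -> derive1 x t = - gradient f (x t) - C^T *m lam t
    & forall t, 0 < t ->
        derive1 lam t = - (Kp *: (C *m (gradient f (x t) + C^T *m lam t)))
                    + Ki *: (C *m x t + d)].

(* Main.v *)
Require Import Defs.
From HB Require Import structures.
From mathcomp Require Import all_boot all_order all_algebra.
From mathcomp Require Import all_classical all_reals all_analysis.
From mathcomp Require Import ring lra.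

Set Implicit Arguments.
Unset Strict Implicit.
Unset Printing Implicit Defensive.

Import Order.TTheory GRing.Theory Num.Theory.
Import numFieldNormedType.Exports.
Local Open Scope classical_set_scope.
Local Open Scope ring_scope.

(** Write z = x - xs, w = lam - ls and g = grad f x - grad f xs. The function
    V = Ki |z|^2 + |w|^2 satisfies
      V' = - 2 Ki <z, g> - 2 Kp <C^T w, g> - 2 Kp |C^T w|^2,
    since the terms in Ki <z, C^T w> cancel. By - 2 <u, g> <= |u|^2 + |g|^2 and the
    cocoercivity |g|^2 <= beta2 <z, g> (Baillon-Haddad),
      V' <= - (2 Ki - Kp beta2) <z, g> - Kp |C^T w|^2 <= - mu V,
    the last step by <z, g> >= beta1 |z|^2 and |C^T w|^2 >= alpha1 |w|^2. *)

(** * Euclidean inner product *)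

Definition dot {R : realType} {n : nat} (u v : 'cV[R]_n) : R :=
  \sum_i u i 0 * v i 0.

Lemma dotC (R : realType) n (u v : 'cV[R]_n) : dot u v = dot v u.
Proof. by apply: eq_bigr => i _; rewrite mulrC. Qed.

Lemma dotDl (R : realType) n (u v w : 'cV[R]_n) :
  dot (u + v) w = dot u w + dot v w.
Proof. by rewrite -big_split; apply: eq_bigr => i _; rewrite mxE mulrDl. Qed.

Lemma dotDr (R : realType) n (u v w : 'cV[R]_n) :
  dot u (v + w) = dot u v + dot u w.
Proof. by rewrite dotC dotDl !(dotC u). Qed.

Lemma dotZl (R : realType) n a (u v : 'cV[R]_n) :
  dot (a *: u) v = a * dot u v.
Proof. by rewrite mulr_sumr; apply: eq_bigr => i _; rewrite mxE mulrA. Qed.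

Lemma dotZr (R : realType) n a (u v : 'cV[R]_n) :
  dot u (a *: v) = a * dot u v.
Proof. by rewrite dotC dotZl dotC. Qed.

Lemma dotNl (R : realType) n (u v : 'cV[R]_n) : dot (- u) v = - dot u v.
Proof. by rewrite -scaleN1r dotZl mulN1r. Qed.

Lemma dotNr (R : realType) n (u v : 'cV[R]_n) : dot u (- v) = - dot u v.
Proof. by rewrite dotC dotNl dotC. Qed.

Lemma dot_ge0 (R : realType) n (u : 'cV[R]_n) : 0 <= dot u u.
Proof. by apply: sumr_ge0 => i _; rewrite -expr2 sqr_ge0. Qed.

Lemma dot_trmx (R : realType) n (u v : 'cV[R]_n) : (u^T *m v) 0 0 = dot u v.
Proof. by rewrite mxE; apply: eq_bigr => i _; rewrite mxE. Qed.

Lemma dot_mulmx (R : realType) m n (A : 'M[R]_(m, n)) u v :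
  dot u (A *m v) = dot (A^T *m u) v.
Proof. by rewrite -!dot_trmx trmx_mul trmxK mulmxA. Qed.

Lemma enormE (R : realType) n (u : 'cV[R]_n) : enorm u = Num.sqrt (dot u u).
Proof. by []. Qed.

Lemma loewner_leP (R : realType) n (M N : 'M[R]_n) (v : 'cV[R]_n) :
  loewner_le M N -> dot v (M *m v) <= dot v (N *m v).
Proof.
move=> /(_ v).
by rewrite -mulmxA dot_trmx mulmxBl dotDr dotNr subr_ge0.
Qed.

(** * Consequences of the Hessian bounds, by restriction to lines *)

Section calculus_along_lines.
Context {R : realType} {n : nat}.
Implicit Types (f : 'cV[R]_n -> R) (u v w x y z : 'cV[R]_n).

Lemma is_derive_line f y v s : derivable f (y + s *: v) v ->
  is_derive s 1 (fun t : R => f (y + t *: v)) ('D_v f (y + s *: v)).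
Proof.
rewrite /derivable /derive => df.
have E : (fun h : R => h^-1 *: (f (y + (h *: (1:R) + s) *: v) - f (y + s *: v)))
  = (fun h => h^-1 *: ((f \o shift (y + s *: v)) (h *: v) - f (y + s *: v))).
  apply/funext => h /=.
  by rewrite [_ *: (1 : R)]mulr1 scalerDl addrCA.
by apply: DeriveDef; rewrite /derivable /derive E.
Qed.

(** The differential is linear, so it is determined by its values on the standard basis, which are
    the entries of the gradient. *)
Lemma derive_gradient f x v :
  differentiable f x -> 'D_v f x = dot (gradient f x) v.
Proof.
move=> df; rewrite deriveE //.
have {1}-> : v = \sum_i v i 0 *: delta_mx i 0.
  by rewrite [LHS]matrix_sum_delta; apply: eq_bigr => i _; rewrite big_ord1.
rewrite linear_sum; apply: eq_bigr => i _.
by rewrite linearZ mxE deriveE //= mulrC.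
Qed.

Lemma is_derive_line_gradient f y v s : differentiable f (y + s *: v) ->
  is_derive s 1 (fun t : R => f (y + t *: v)) (dot (gradient f (y + s *: v)) v).
Proof.
move=> df; rewrite -derive_gradient //.
exact/is_derive_line/diff_derivable.
Qed.

Lemma is_derive_line_hessian f y v s :
  differentiable (gradient f) (y + s *: v) ->
  is_derive s 1 (fun t : R => dot (gradient f (y + t *: v)) v)
    (dot v (hessian f (y + s *: v) *m v)).
Proof.
move=> df; set x := y + s *: v in df *.
have dgi i : differentiable (fun z => gradient f z i 0) x.
  apply: (@differentiable_comp _ _ _ _ (gradient f) (fun N : 'cV[R]_n => N i 0)) => //.
  exact: differentiable_coord.
have -> : (fun t : R => dot (gradient f (y + t *: v)) v) =
    \sum_i (fun t : R => gradient f (y + t *: v) i 0 * v i 0).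
  by apply/funext => t; rewrite fct_sumE.
rewrite /dot.
have dsum i : is_derive s 1 (fun t : R => gradient f (y + t *: v) i 0 * v i 0)
    (v i 0 * (hessian f x *m v) i 0).
  have dgiv : derivable (fun z => gradient f z i 0) x v by exact: diff_derivable.
  have := is_derive_line dgiv.
  rewrite derive_gradient // => dg.
  (* Row [i] of the Hessian is the gradient of the [i]-th coordinate of [gradient f]. *)
  have -> : (hessian f x *m v) i 0 =
      dot (gradient (fun z => gradient f z i 0) x) v.
    by rewrite mxE; apply: eq_bigr => j _; rewrite !mxE.
  by apply: is_derive_eq; rewrite scaler0 add0r.
exact: is_derive_sum.
Qed.

(** Mean value theorem on [[0, c]] for the slope of [f] along [v], whose derivative is the quadratic
    form of the Hessian. Integrating instead would require regularity of the Hessian. *)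
Lemma gradient_line_bounds f b1 b2 y v c : twice_differentiable f -> 0 <= c ->
  (forall x, loewner_le b1%:M (hessian f x)) ->
  (forall x, loewner_le (hessian f x) b2%:M) ->
  b1 * c * dot v v <= dot (gradient f (y + c *: v)) v - dot (gradient f y) v
    <= b2 * c * dot v v.
Proof.
move=> df c0 Hlo Hup.
have dg (t : R) : is_derive t 1 (fun t : R => dot (gradient f (y + t *: v)) v)
    (dot v (hessian f (y + t *: v) *m v)).
  by apply: is_derive_line_hessian; have [] := df (y + t *: v).
have [|t _] := @MVT_segment _ _ _ 0 c c0 (fun t _ => dg t).
  by apply: derivable_within_continuous => t _; have [] := dg t.
rewrite scale0r addr0 subr0 => ->.
have := loewner_leP v (Hlo (y + t *: v)); have := loewner_leP v (Hup (y + t *: v)).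
rewrite !mul_scalar_mx !dotZr => hup hlo.
by rewrite -!(mulrAC _ (dot v v)) !ler_wpM2r.
Qed.

Lemma convex_tangent_le f b1 b2 y v : twice_differentiable f -> 0 <= b1 ->
  (forall x, loewner_le b1%:M (hessian f x)) ->
  (forall x, loewner_le (hessian f x) b2%:M) ->
  f y + dot (gradient f y) v <= f (y + v).
Proof.
move=> df b10 Hlo Hup.
have dp (t : R) : is_derive t 1 (fun t : R => f (y + t *: v))
    (dot (gradient f (y + t *: v)) v).
  by apply: is_derive_line_gradient; have [] := df (y + t *: v).
have [|t] := @MVT_segment _ _ _ 0 1 ler01 (fun t _ => dp t).
  by apply: derivable_within_continuous => t _; have [] := dp t.
rewrite in_itv/= => /andP[t0 _].
rewrite scale0r addr0 subr0 mulr1 scale1r => fE.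
have /andP[+ _] := gradient_line_bounds y v df t0 Hlo Hup.
have : 0 <= b1 * t * dot v v by rewrite !mulr_ge0 // dot_ge0.
lra.
Qed.

(** The mean value theorem applied to [f] itself would only give the constant [b2]. Subtracting the
    quadratic term first, as in [q], leaves a slope bounded by [dot (gradient f y) v] and yields
    [b2 / 2]. *)
Lemma descent f b1 b2 y v : twice_differentiable f ->
  (forall x, loewner_le b1%:M (hessian f x)) ->
  (forall x, loewner_le (hessian f x) b2%:M) ->
  f (y + v) <= f y + dot (gradient f y) v + b2 / 2 * dot v v.
Proof.
move=> df Hlo Hup.
pose q (t : R) := f (y + t *: v) - b2 / 2 * dot v v * t ^+ 2.
have dq (t : R) : is_derive t 1 q
    (dot (gradient f (y + t *: v)) v - b2 * t * dot v v).
  have dp : is_derive t 1 (fun t : R => f (y + t *: v))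
      (dot (gradient f (y + t *: v)) v).
    by apply: is_derive_line_gradient; have [] := df (y + t *: v).
  apply: is_derive_eq.
  by rewrite /GRing.scale /=; field.
have [|t] := @MVT_segment _ _ _ 0 1 ler01 (fun t _ => dq t).
  by apply: derivable_within_continuous => t _; have [] := dq t.
rewrite in_itv/= => /andP[t0 _].
rewrite /q scale0r addr0 subr0 mulr1 scale1r => fE.
have /andP[_ +] := gradient_line_bounds y v df t0 Hlo Hup.
lra.
Qed.

(** The value of [f] at the gradient step [x - b2^-1 *: g] is bounded below by the tangent at [y]
    and above by [descent] at [x]. This step length minimizes the quadratic upper bound of [f] minus
    its tangent at [y]. *)
Lemma convex_tangent_gap f b1 b2 x y : twice_differentiable f ->
  0 <= b1 -> 0 < b2 ->
  (forall x, loewner_le b1%:M (hessian f x)) ->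
  (forall x, loewner_le (hessian f x) b2%:M) ->
  f y + dot (gradient f y) (x - y) + b2^-1 / 2 *
    dot (gradient f x - gradient f y) (gradient f x - gradient f y) <= f x.
Proof.
move=> df b10 b20 Hlo Hup; set g := gradient f x - gradient f y.
have := convex_tangent_le y (x - y - b2^-1 *: g) df b10 Hlo Hup.
have := descent x (- (b2^-1 *: g)) df Hlo Hup.
have -> : y + (x - y - b2^-1 *: g) = x - b2^-1 *: g by rewrite addrA subrKC.
rewrite (dotDr _ (x - y)) !(dotNl, dotNr, dotZl, dotZr) opprK.
have -> : b2 / 2 * (b2^-1 * (b2^-1 * dot g g)) = b2^-1 / 2 * dot g g.
  by field; rewrite gt_eqF.
have -> : dot g g = dot (gradient f x) g - dot (gradient f y) g.
  by rewrite {1}/g dotDl dotNl.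
lra.
Qed.

(* Baillon-Haddad: the tangent gap at y seen from x plus that at x seen from y. *)
Lemma gradient_cocoercive f b1 b2 x y : twice_differentiable f ->
  0 <= b1 -> 0 < b2 ->
  (forall x, loewner_le b1%:M (hessian f x)) ->
  (forall x, loewner_le (hessian f x) b2%:M) ->
  dot (gradient f x - gradient f y) (gradient f x - gradient f y) <=
    b2 * dot (gradient f x - gradient f y) (x - y).
Proof.
move=> df b10 b20 Hlo Hup; set g := gradient f x - gradient f y.
have := convex_tangent_gap x y df b10 b20 Hlo Hup.
have := convex_tangent_gap y x df b10 b20 Hlo Hup.
rewrite /= -[gradient f y - gradient f x]opprB -[y - x]opprB -/g.
rewrite !(dotNl, dotNr) opprK => h1 h2.
rewrite -ler_pdivrMl //.
have -> : dot g (x - y) = dot (gradient f x) (x - y) - dot (gradient f y) (x - y).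
  by rewrite {1}/g dotDl dotNl.
lra.
Qed.

Lemma gradient_strongly_monotone f b1 b2 x y : twice_differentiable f ->
  (forall x, loewner_le b1%:M (hessian f x)) ->
  (forall x, loewner_le (hessian f x) b2%:M) ->
  b1 * dot (x - y) (x - y) <= dot (gradient f x - gradient f y) (x - y).
Proof.
move=> df Hlo Hup.
have /andP[+ _] := gradient_line_bounds y (x - y) df ler01 Hlo Hup.
by rewrite mulr1 scale1r subrKC -dotNl -dotDl.
Qed.

End calculus_along_lines.

(** * Exponential decay from a differential inequality *)

(** Integrating factor: [W], the product of [V s] and [expR (mu * s)], has nonpositive derivative on
    the open half-line. *)
Lemma gronwall_decay (R : realType) (V : R -> R) (mu : R) :
  derivable_oy_Rcontinuous V 0 ->
  (forall t, 0 < t -> derive1 V t <= - mu * V t) ->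
  forall t, 0 <= t -> V t <= V 0 * expR (- mu * t).
Proof.
move=> [dV cV] V'le t t0.
pose E (s : R) := expR (mu * s).
have dE (s : R) : is_derive s 1 E (mu * expR (mu * s)).
  have dm : is_derive s 1 (fun s : R => mu * s) mu.
    by apply: is_derive_eq; exact: mulr1.
  by rewrite mulrC; exact: is_derive1_comp.
pose W (s : R) := V s * E s.
have dW (s : R) : 0 < s -> is_derive s 1 W (E s * (derive1 V s + mu * V s)).
  move=> s0; have /derivableP : derivable V s 1 by apply: dV; rewrite in_itv/= s0.
  rewrite -derive1E => dVs.
  apply: is_derive_eq; rewrite /GRing.scale /= /E; ring.
have W0t : W t <= W 0.
  apply: (@ler0_derive1_nincry _ W 0) => //.
  - by move=> s; rewrite in_itv/= andbT => /dW[].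
  - move=> s; rewrite in_itv/= andbT => s0; rewrite derive1E.
    have [_ ->] := dW _ s0.
    rewrite mulr_ge0_le0 ?expR_ge0 //.
    by have := V'le _ s0; lra.
  (* Right continuity at 0 extends the monotonicity of [W] to the closed half-line, so that [W 0]
     can serve as the bound. *)
  - apply: derivable_oy_Rcontinuous_within_itvcy; split.
      by move=> s; rewrite in_itv/= andbT => /dW[].
    apply: cvgM => //; apply: cvg_within_filter.
    by apply/differentiable_continuous/derivable1_diffP; have [] := dE 0.
move: W0t; rewrite /W /E mulr0 expR0 mulr1 => W0t.
by rewrite mulNr expRN ler_pdivlMr ?expR_gt0.
Qed.

(** * Regularity of the two summands of the Lyapunov function *)

Section squared_distance_along_curves.
Context {R : realType} {n : nat}.
Implicit Types (z : R -> 'cV[R]_n) (a : 'cV[R]_n).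

Lemma is_derive_sqdist z a t : derivable z t 1 ->
  is_derive t 1 (fun s => dot (z s - a) (z s - a))
    (2 * dot (z t - a) (derive1 z t)).
Proof.
move=> dz.
have dzi i : is_derive t 1 (fun s => z s i 0) (derive1 z t i 0).
  rewrite derive1E derive_mx // mxE; apply: derivableP.
  exact: (proj1 (derivable_mxP z t 1) dz).
have -> : (fun s => dot (z s - a) (z s - a)) =
    \sum_i (fun s => (z s i 0 - a i 0) * (z s i 0 - a i 0)).
  apply/funext => s; rewrite fct_sumE.
  by apply: eq_bigr => i _; rewrite !mxE.
rewrite mulr_sumr; apply: is_derive_sum => i.
apply: is_derive_eq; rewrite !mxE /GRing.scale /=; ring.
Qed.

Lemma sqdist_derivable_oy_Rcontinuous z a t0 :
  derivable_oy_Rcontinuous z t0 ->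
  derivable_oy_Rcontinuous (fun s => dot (z s - a) (z s - a)) t0.
Proof.
move=> [dz cz]; split=> [t /dz/(is_derive_sqdist a)[]//|].
apply: cvg_big => [/=|i _]; first exact: add_continuous.
have zi : z s i 0 @[s --> t0^'+] --> z t0 i 0.
  exact: (cvg_comp _ _ cz (@coord_continuous _ _ _ i 0 (z t0))).
have zai : (z s - a) i 0 @[s --> t0^'+] --> (z t0 - a) i 0.
  rewrite mxE; under eq_fun do rewrite !mxE.
  by apply: cvgD => //; rewrite mxE; exact: cvg_cst.
exact: cvgM.
Qed.

End squared_distance_along_curves.

(** * The decay rate and the dissipation inequality *)

Lemma mu_gt0 (R : realType) (beta1 beta2 alpha1 Ki Kp : R) :
  0 < beta1 -> 0 < beta2 -> 0 < alpha1 -> 0 < Ki -> 0 < Kp ->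
  Kp < 2 * Ki / beta2 ->
  0 < Num.min (Kp * alpha1) (2 * beta1 - Kp / Ki * beta1 * beta2).
Proof.
move=> b10 b20 a10 Ki0 Kp0; rewrite ltr_pdivlMr // => Kp_lt.
rewrite lt_min mulr_gt0 //=.
(* In this factored form, positivity is exactly the gain condition on [Kp]. *)
have -> : 2 * beta1 - Kp / Ki * beta1 * beta2 =
    beta1 / Ki * (2 * Ki - Kp * beta2) by field; rewrite gt_eqF.
by rewrite mulr_gt0 ?divr_gt0 // subr_gt0.
Qed.

(** The inequality at a fixed time, as algebra in [z], [g], [w]: the objective enters only through
    strong monotonicity and cocoercivity of its gradient. *)
Lemma lyapunov_dissipation (R : realType) (n m : nat) (C : 'M[R]_(m, n))
    (z g : 'cV[R]_n) (w : 'cV[R]_m) (beta1 beta2 alpha1 Ki Kp mu : R) :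
  mu <= Kp * alpha1 -> mu <= 2 * beta1 - Kp / Ki * beta1 * beta2 ->
  0 < beta2 -> 0 < Ki -> 0 < Kp -> Kp < 2 * Ki / beta2 ->
  loewner_le alpha1%:M (C *m C^T) ->
  beta1 * dot z z <= dot g z -> dot g g <= beta2 * dot g z ->
  Ki * (2 * dot z (- (g + C^T *m w))) +
    2 * dot w (- (Kp *: (C *m (g + C^T *m w))) + Ki *: (C *m z)) <=
  - mu * (Ki * dot z z + dot w w).
Proof.
move=> mu_le1 mu_le2 b20 Ki0 Kp0; rewrite ltr_pdivlMr // => Kp_lt CCT zz gg.
have ww : alpha1 * dot w w <= dot (C^T *m w) (C^T *m w).
  by rewrite -dotZr -mul_scalar_mx -dot_mulmx mulmxA; exact: loewner_leP.
set u := C^T *m w in ww *.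
(* Moving [C] to the other side turns every occurrence of [w] on the left into [u], and the terms in
   [Ki * dot u z] become opposite. *)
rewrite dotDr !dotNr !dotZr !dot_mulmx -/u !dotDr (dotC z g) (dotC z u).
(* Young's inequality for the cross term; it spends half of the dissipation [2 * Kp * dot u u] and
   leaves the other half for [mu1]. *)
have gu : 0 <= dot g g + 2 * dot u g + dot u u.
  have := dot_ge0 (g + u); rewrite !(dotDl, dotDr) (dotC g u); lra.
have mu1 : mu * dot w w <= Kp * dot u u.
  apply: (@le_trans _ _ (Kp * alpha1 * dot w w)).
    by rewrite ler_wpM2r ?dot_ge0.
  by rewrite -mulrA ler_pM2l.
have mu2 : mu * Ki * dot z z <= (2 * Ki - Kp * beta2) * dot g z.
  apply: (@le_trans _ _ ((2 * Ki - Kp * beta2) * (beta1 * dot z z))).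
    rewrite mulrA ler_wpM2r ?dot_ge0 //.
    apply: (@le_trans _ _ ((2 * beta1 - Kp / Ki * beta1 * beta2) * Ki)).
      by rewrite ler_pM2r.
    by rewrite le_eqVlt; apply/orP; left; apply/eqP; field; rewrite gt_eqF.
  by rewrite ler_pM2l // subr_gt0.
(* With the products by [Kp] formed, the goal is linear in the remaining monomials. *)
have Kpgu := mulr_ge0 (ltW Kp0) gu.
have Kpgg : Kp * dot g g <= Kp * (beta2 * dot g z) by rewrite ler_pM2l.
lra.
Qed.

(** Taking the square root halves the exponent. The added 1 keeps the constant positive when
    [V0 = 0], that is, for a start at equilibrium. *)
Lemma enorm_le_decay (R : realType) n (v : 'cV[R]_n) (k V0 mu t : R) :
  0 < k -> 0 <= V0 -> k * dot v v <= V0 * expR (- mu * t) ->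
  enorm v <= (Num.sqrt (V0 / k) + 1) * expR (- (1 / 2) * mu * t).
Proof.
move=> k0 V00 kv.
apply: (@le_trans _ _ (Num.sqrt (V0 / k) * expR (- (1 / 2) * mu * t))).
  have -> : expR (- (1 / 2) * mu * t) = Num.sqrt (expR (- mu * t)).
    have -> : - mu * t = - (1 / 2) * mu * t + - (1 / 2) * mu * t by field.
    by rewrite expRD -expr2 sqrtr_sqr ger0_norm // expR_ge0.
  rewrite enormE -sqrtrM ?divr_ge0 ?(ltW k0) // ler_sqrt; last first.
    by rewrite mulr_ge0 ?divr_ge0 ?expR_ge0 ?(ltW k0).
  by rewrite mulrAC ler_pdivlMr // mulrC.
by rewrite ler_wpM2r ?expR_ge0 // lerDl.
Qed.

Theorem theorem2 (R : realType) (n m : nat)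
    (f : 'cV[R]_n -> R) (C : 'M[R]_(m, n)) (d : 'cV[R]_m)
    (xs : 'cV[R]_n) (ls : 'cV[R]_m)
    (beta1 beta2 alpha1 alpha2 Ki Kp : R)
    (f_strongly_convex : strongly_convex f)
    (f_twice_diff : twice_differentiable f)
    (beta1_gt0 : 0 < beta1) (beta1_lt_beta2 : beta1 < beta2)
    (hessian_bounds : forall (x : 'cV[R]_n) (t : R), 0 <= t <= 1 ->
       loewner_le beta1%:M (hessian f (xs + t *: (x - xs))) /\
       loewner_le (hessian f (xs + t *: (x - xs))) beta2%:M)
    (C_full_rank : \rank C = minn m n)
    (alpha1_gt0 : 0 < alpha1) (alpha1_le_alpha2 : alpha1 <= alpha2)
    (CCT_lower : loewner_le alpha1%:M (C *m C^T))
    (CCT_upper : loewner_le (C *m C^T) alpha2%:M)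
    (stationarity : gradient f xs + C^T *m ls = 0)
    (feasibility : C *m xs + d = 0)
    (Ki_gt0 : 0 < Ki) (Kp_gt0 : 0 < Kp)
    (Kp_lt : Kp < 2 * Ki / beta2) :
  let mu := Num.min (Kp * alpha1) (2 * beta1 - Kp / Ki * beta1 * beta2) in
  0 < mu /\
  forall (x : R -> 'cV[R]_n) (lam : R -> 'cV[R]_m),
    pi_cmo_solution f C d Kp Ki x lam ->
    exists c1 c2 : R,
      [/\ 0 < c1, 0 < c2 &
          forall t : R, 0 <= t ->
            enorm (x t - xs) <= c1 * expR (- (1 / 2) * mu * t) /\
            enorm (lam t - ls) <= c2 * expR (- (1 / 2) * mu * t)].
Proof.
move=> mu; have beta2_gt0 := lt_trans beta1_gt0 beta1_lt_beta2.
split=> [|x lam [xC lamC x' lam']]; first exact: mu_gt0.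
(* At [t = 1] the point on the segment from [xs] is [y] itself, so the bounds hold everywhere. *)
have Hlo y : loewner_le beta1%:M (hessian f y).
  have [] := hessian_bounds y 1; first by rewrite ler01 lexx.
  by rewrite scale1r subrKC.
have Hup y : loewner_le (hessian f y) beta2%:M.
  have [] := hessian_bounds y 1; first by rewrite ler01 lexx.
  by rewrite scale1r subrKC.
pose Vx t := dot (x t - xs) (x t - xs).
pose Vl t := dot (lam t - ls) (lam t - ls).
pose V t := Ki * Vx t + Vl t.
have [dVx cVx] := sqdist_derivable_oy_Rcontinuous xs xC.
have [dVl cVl] := sqdist_derivable_oy_Rcontinuous ls lamC.
have dV (t : R) : 0 < t -> is_derive t 1 V
    (Ki * (2 * dot (x t - xs) (derive1 x t)) +
     2 * dot (lam t - ls) (derive1 lam t)).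
  move=> t0; have t_in : t \in `]0, +oo[ by rewrite in_itv/= t0.
  have dx := is_derive_sqdist xs (xC.1 t t_in).
  have dl := is_derive_sqdist ls (lamC.1 t t_in).
  by apply: is_derive_eq; rewrite /GRing.scale /= ?scaler0 ?addr0.
have Vdecay (t : R) : 0 <= t -> V t <= V 0 * expR (- mu * t).
  apply: gronwall_decay.
    split=> [s|]; first by rewrite in_itv/= andbT => /dV[].
    by apply: cvgD => //; apply: cvgM => //; exact: cvg_cst.
  move=> {}t t0; rewrite derive1E; have [_ ->] := dV _ t0.
  pose g := gradient f (x t) - gradient f xs.
  (* The optimality conditions recenter both right-hand sides at the equilibrium. *)
  have gE : gradient f (x t) + C^T *m lam t = g + C^T *m (lam t - ls).
    rewrite mulmxBr /g addrACA -opprD.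
    by rewrite stationarity subr0.
  have zE : C *m x t + d = C *m (x t - xs).
    by rewrite mulmxBr -[LHS]subr0 -feasibility opprD addrACA subrr addr0.
  rewrite x' // lam' // -opprD gE zE.
  apply: (@lyapunov_dissipation _ _ _ _ _ _ _ beta1 beta2 alpha1) => //.
  - by rewrite ge_min lexx.
  - by rewrite ge_min lexx orbT.
  - exact: (gradient_strongly_monotone _ _ f_twice_diff Hlo Hup).
  - exact: (gradient_cocoercive _ _ f_twice_diff (ltW beta1_gt0) beta2_gt0 Hlo Hup).
have Vx_ge0 t : 0 <= Ki * Vx t by rewrite mulr_ge0 ?dot_ge0 // ltW.
have Vl_ge0 t : 0 <= Vl t by exact: dot_ge0.
have V0_ge0 : 0 <= V 0 by rewrite addr_ge0.
(* [Ki] and 1 are the weights of the two squared distances in [V]; each weighted term is at most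
   [V], the other being nonnegative. *)
exists (Num.sqrt (V 0 / Ki) + 1), (Num.sqrt (V 0 / 1) + 1).
split; rewrite ?ltr_pwDr ?sqrtr_ge0 // => t /Vdecay Vt.
split; apply: enorm_le_decay => //; apply: le_trans Vt.
  by rewrite lerDl.
by rewrite mul1r lerDr.
Qed.
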